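(* For all $a\in\{-1,1\}$ and all $\lambda\in\mathbb{C}$ with $|\lambda|=1$, let \[\mathfrak{X}_{a,\lambda}=\begin{pmatrix}\mathfrak{X}_{(11)}&\mathfrak{X}_{(12)}\\ \mathfrak{X}_{(21)}&\mathfrak{X}_{(22)}\end{pmatrix}=\begin{pmatrix}1\dotplus a\dotplus -a\dotplus -1\dotplus\begin{pmatrix}0&0\\0&0\end{pmatrix}&0\dotplus0\dotplus0\dotplus0\dotplus\begin{pmatrix}0&\lambda\\ \imath a\lambda&0\end{pmatrix}\\ 0\dotplus0\dotplus0\dotplus0\dotplus\begin{pmatrix}0&\bar\lambda\\ -\imath a\bar\lambda&0\end{pmatrix}&1\dotplus -a\dotplus a\dotplus -1\dotplus\begin{pmatrix}0&0\\0&0\end{pmatrix}\end{pmatrix}\in\mathcal{M}_2(\mathcal{A}).\] Then $\mathfrak{X}_{a,\lambda}$ is a fundamental representation of $\mathbb{KP}$, that is, an irreducible representation whose coefficients generate the algebra $\mathcal{A}$.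
   Context: The Kac-Paljutkin finite quantum group $\mathbb{KP}=(\mathcal{A},\Delta)$: $\mathcal{A}=\mathbb{C}\oplus\mathbb{C}\oplus\mathbb{C}\oplus\mathbb{C}\oplus\mathcal{M}_2(\mathbb{C})$ is the multi-matrix $*$-algebra with usual multiplication and involution; elements are written $x_1\dotplus x_2\dotplus x_3\dotplus x_4\dotplus C$ with $x_i\in\mathbb{C}$, $C\in\mathcal{M}_2(\mathbb{C})$. Let $e_1,\dots,e_4$ be the units of the four copies of $\mathbb{C}$ and $E_{ij}$ ($1\le i,j\le2$) the matrix units of $\mathcal{M}_2(\mathbb{C})$; $\imath$ is the imaginary unit. The coproduct $\Delta:\mathcal{A}\to\mathcal{A}\otimes\mathcal{A}$ is the linear map \begin{align*} \Delta(e_1)=&\ e_1\otimes e_1+e_2\otimes e_2+e_3\otimes e_3+e_4\otimes e_4+\tfrac12E_{11}\otimes E_{11}+\tfrac12E_{12}\otimes E_{12}+\tfrac12E_{21}\otimes E_{21}+\tfrac12E_{22}\otimes E_{22}\\ \Delta(e_2)=&\ e_1\otimes e_2+e_2\otimes e_1+e_3\otimes e_4+e_4\otimes e_3+\tfrac12E_{11}\otimes E_{22}+\tfrac12E_{22}\otimes E_{11}-\tfrac{\imath}2E_{12}\otimes E_{21}+\tfrac{\imath}2E_{21}\otimes E_{12}\\ \Delta(e_3)=&\ e_1\otimes e_3+e_3\otimes e_1+e_2\otimes e_4+e_4\otimes e_2+\tfrac12E_{11}\otimes E_{22}+\tfrac12E_{22}\otimes E_{11}+\tfrac{\imath}2E_{12}\otimes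 E_{21}-\tfrac{\imath}2E_{21}\otimes E_{12}\\ \Delta(e_4)=&\ e_1\otimes e_4+e_4\otimes e_1+e_2\otimes e_3+e_3\otimes e_2+\tfrac12E_{11}\otimes E_{11}+\tfrac12E_{22}\otimes E_{22}-\tfrac12E_{12}\otimes E_{12}-\tfrac12E_{21}\otimes E_{21}\\ \Delta(E_{11})=&\ e_1\otimes E_{11}+E_{11}\otimes e_1+e_2\otimes E_{22}+E_{22}\otimes e_2+e_3\otimes E_{22}+E_{22}\otimes e_3+e_4\otimes E_{11}+E_{11}\otimes e_4\\ \Delta(E_{12})=&\ e_1\otimes E_{12}+E_{12}\otimes e_1+\imath e_2\otimes E_{21}-\imath E_{21}\otimes e_2-\imath e_3\otimes E_{21}+\imath E_{21}\otimes e_3-e_4\otimes E_{12}-E_{12}\otimes e_4\\ \Delta(E_{21})=&\ e_1\otimes E_{21}+E_{21}\otimes e_1-\imath e_2\otimes E_{12}+\imath E_{12}\otimes e_2+\imath e_3\otimes E_{12}-\imath E_{12}\otimes e_3-e_4\otimes E_{21}-E_{21}\otimes e_4\\ \Delta(E_{22})=&\ e_1\otimes E_{22}+E_{22}\otimes e_1+e_2\otimes E_{11}+E_{11}\otimes e_2+e_3\otimes E_{11}+E_{11}\otimes e_3+e_4\otimes E_{22}+E_{22}\otimes e_4. \end{align*} The counit is $\varepsilon(x_1\dotplus x_2\dotplus x_3\dotplus x_4\dotplus C)=x_1$. A $d$-dimensional representation of $\mathbb{KP}$ is an invertible matrix $w=(w_{ij})\in\mathcal{M}_d(\mathcal{A})$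 with $\Delta(w_{ij})=\sum_kw_{ik}\otimes w_{kj}$. It is irreducible if the only $T\in\mathcal{M}_d(\mathbb{C})$ with $(T\otimes1)w=w(T\otimes1)$ are the scalar multiples of the identity. *)

(* Defs.v *)
From HB Require Import structures.
From mathcomp Require Export all_boot all_order all_algebra reals complex.
Set Implicit Arguments.
Unset Strict Implicit.
Unset Printing Implicit Defensive.
Import Order.TTheory GRing.Theory Num.Theory VectorInternalTheory.
Local Open Scope ring_scope.

(* The library has no tensor product. For finite-dimensional U and V it is    *)
(* modelled by matrices: u ⊗ v is the outer product of the coordinates of u   *)
(* and v; [tensor_universal] is the universal property of this model.         *)
Notation tensor U V := 'M_(dim U, dim V).

Section Tensor.
Variables (K : fieldType) (U V : vectType K).

Definition tens (u : U) (v : V) : tensor U V := (v2r u)^T *m v2r v.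

Lemma tens_linearl v : linear (tens^~ v).
Proof. by move=> k x y; rewrite /tens linearP linearP /= mulmxDl -scalemxAl. Qed.

Lemma tens_linearr u : linear (tens u).
Proof. by move=> k x y; rewrite /tens linearP /= mulmxDr -scalemxAr. Qed.

Lemma tensor_universal (W : lmodType K) (f : U -> V -> W) :
    (forall v, linear (f^~ v)) -> (forall u, linear (f u)) ->
  exists2 g : {linear tensor U V -> W}, (forall u v, g (tens u v) = f u v)
    & forall h : {linear tensor U V -> W},
        (forall u v, h (tens u v) = f u v) -> h =1 g.
Proof.
move=> fl fr.
pose b i j := f (r2v (delta_mx 0 i)) (r2v (delta_mx 0 j)).
pose g0 (t : tensor U V) : W := \sum_i \sum_j t i j *: b i j.
have g0_lin : linear g0.
  move=> k s t; rewrite /g0 scaler_sumr -big_split /=; apply: eq_bigr => i _.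
  rewrite scaler_sumr -big_split /=; apply: eq_bigr => j _.
  by rewrite !mxE scalerDl scalerA.
pose gL := GRing.isLinear.Build K (tensor U V) W *:%R g0 g0_lin.
pose g : {linear tensor U V -> W} := HB.pack g0 gL.
have fE u v : f u v = g0 (tens u v).
  pose flL v := GRing.isLinear.Build K U W *:%R (f^~ v) (fl v).
  pose fL v : {linear U -> W} := HB.pack (f^~ v) (flL v).
  pose frL u := GRing.isLinear.Build K V W *:%R (f u) (fr u).
  pose fR u : {linear V -> W} := HB.pack (f u) (frL u).
  rewrite -[f u v]/(fL v u) -{1}(v2rK u) (row_sum_delta (v2r u)) !linear_sum.
  apply: eq_bigr => i _; rewrite !linearZ /= -[f _ v]/(fR _ v).
  rewrite -{1}(v2rK v) (row_sum_delta (v2r v)) !linear_sum.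
  apply: eq_bigr => j _; rewrite !linearZ /= scalerA; congr (_ *: _).
  by rewrite /tens mxE big_ord1 mxE mulrC.
exists g => [u v|h hE t]; first by rewrite fE.
rewrite [t in LHS]matrix_sum_delta linear_sum; apply: eq_bigr => i _.
rewrite linear_sum; apply: eq_bigr => j _.
rewrite linearZ /= /b -hE /tens !r2vK; congr (_ *: h _).
by rewrite trmx_delta mul_delta_mx.
Qed.

End Tensor.

Notation "u ⊗ v" := (tens u v) (at level 40, left associativity) : ring_scope.

Definition mx2 (T : Type) (a b c d : T) : 'M[T]_2 :=
  \matrix_(i, j) if i == 0 then if j == 0 then a else b
                 else if j == 0 then c else d.

(* The multi-matrix algebra with its componentwise operations; C^o is C as an *)
(* algebra over itself.                                                       *)
Notation KP C := (C^o * C^o * C^o * C^o * 'M[C]_2)%type.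

Section KacPaljutkin.
Variable C : numClosedFieldType.

Definition dotplus (x1 x2 x3 x4 : C) (M : 'M[C]_2) : KP C :=
  (x1, x2, x3, x4, M).

Definition e1 : KP C := dotplus 1 0 0 0 0.
Definition e2 : KP C := dotplus 0 1 0 0 0.
Definition e3 : KP C := dotplus 0 0 1 0 0.
Definition e4 : KP C := dotplus 0 0 0 1 0.
Definition E11 : KP C := dotplus 0 0 0 0 (mx2 1 0 0 0).
Definition E12 : KP C := dotplus 0 0 0 0 (mx2 0 1 0 0).
Definition E21 : KP C := dotplus 0 0 0 0 (mx2 0 0 1 0).
Definition E22 : KP C := dotplus 0 0 0 0 (mx2 0 0 0 1).

Local Notation AA := (tensor (KP C) (KP C)).

Definition Delta_e1 : AA :=
  e1 ⊗ e1 + e2 ⊗ e2 + e3 ⊗ e3 + e4 ⊗ e4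
  + 2^-1 *: (E11 ⊗ E11) + 2^-1 *: (E12 ⊗ E12)
  + 2^-1 *: (E21 ⊗ E21) + 2^-1 *: (E22 ⊗ E22).

Definition Delta_e2 : AA :=
  e1 ⊗ e2 + e2 ⊗ e1 + e3 ⊗ e4 + e4 ⊗ e3
  + 2^-1 *: (E11 ⊗ E22) + 2^-1 *: (E22 ⊗ E11)
  - ('i / 2) *: (E12 ⊗ E21) + ('i / 2) *: (E21 ⊗ E12).

Definition Delta_e3 : AA :=
  e1 ⊗ e3 + e3 ⊗ e1 + e2 ⊗ e4 + e4 ⊗ e2
  + 2^-1 *: (E11 ⊗ E22) + 2^-1 *: (E22 ⊗ E11)
  + ('i / 2) *: (E12 ⊗ E21) - ('i / 2) *: (E21 ⊗ E12).

Definition Delta_e4 : AA :=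
  e1 ⊗ e4 + e4 ⊗ e1 + e2 ⊗ e3 + e3 ⊗ e2
  + 2^-1 *: (E11 ⊗ E11) + 2^-1 *: (E22 ⊗ E22)
  - 2^-1 *: (E12 ⊗ E12) - 2^-1 *: (E21 ⊗ E21).

Definition Delta_E11 : AA :=
  e1 ⊗ E11 + E11 ⊗ e1 + e2 ⊗ E22 + E22 ⊗ e2
  + e3 ⊗ E22 + E22 ⊗ e3 + e4 ⊗ E11 + E11 ⊗ e4.

Definition Delta_E12 : AA :=
  e1 ⊗ E12 + E12 ⊗ e1 + 'i *: (e2 ⊗ E21) - 'i *: (E21 ⊗ e2)
  - 'i *: (e3 ⊗ E21) + 'i *: (E21 ⊗ e3) - e4 ⊗ E12 - E12 ⊗ e4.

Definition Delta_E21 : AA :=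
  e1 ⊗ E21 + E21 ⊗ e1 - 'i *: (e2 ⊗ E12) + 'i *: (E12 ⊗ e2)
  + 'i *: (e3 ⊗ E12) - 'i *: (E12 ⊗ e3) - e4 ⊗ E21 - E21 ⊗ e4.

Definition Delta_E22 : AA :=
  e1 ⊗ E22 + E22 ⊗ e1 + e2 ⊗ E11 + E11 ⊗ e2
  + e3 ⊗ E11 + E11 ⊗ e3 + e4 ⊗ E22 + E22 ⊗ e4.

Definition Delta (x : KP C) : AA :=
  let: (x1, x2, x3, x4, M) := x in
  x1 *: Delta_e1 + x2 *: Delta_e2 + x3 *: Delta_e3 + x4 *: Delta_e4
  + M 0 0 *: Delta_E11 + M 0 1 *: Delta_E12
  + M 1 0 *: Delta_E21 + M 1 1 *: Delta_E22.

(* [unitmx] is only available over commutative rings. *)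
Definition invertible_mx d (w : 'M[KP C]_d) : Prop :=
  exists2 v : 'M[KP C]_d, v *m w = 1%:M & w *m v = 1%:M.

Definition representation d (w : 'M[KP C]_d) : Prop :=
  invertible_mx w /\ forall i j, Delta (w i j) = \sum_k w i k ⊗ w k j.

(* T ⊗ 1, as a matrix over KP C *)
Definition scalar_ext d (T : 'M[C]_d) : 'M[KP C]_d :=
  map_mx (fun c => c%:A) T.

Definition irreducible d (w : 'M[KP C]_d) : Prop :=
  forall T : 'M[C]_d, scalar_ext T *m w = w *m scalar_ext T ->
    exists c : C, T = c%:M.

(* [GRing.subalg_closed] is closure under the unital algebra operations. *)
Definition coefs_generate d (w : 'M[KP C]_d) : Prop :=
  forall S : {pred KP C}, GRing.subalg_closed S ->
    (forall i j, w i j \in S) -> forall x, x \in S.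

Definition fundamental_representation d (w : 'M[KP C]_d) : Prop :=
  [/\ representation w, irreducible w & coefs_generate w].

Definition frakX (a lambda : C) : 'M[KP C]_2 :=
  mx2 (dotplus 1 a (- a) (-1) 0)
      (dotplus 0 0 0 0 (mx2 0 lambda ('i * a * lambda) 0))
      (dotplus 0 0 0 0 (mx2 0 lambda^* (- 'i * a * lambda^*) 0))
      (dotplus 1 (- a) a (-1) 0).

End KacPaljutkin.

(* Main.v *)
From HB Require Import structures.
Require Import Defs.
From mathcomp Require Import ring.
Import GRing.Theory Num.Theory VectorInternalTheory.
Local Open Scope ring_scope.

(** The four coefficients belong to two one-parameter families in the algebra:
    g(s) = e1 + s e2 - s e3 - e4, in the commutative summand, and
    h(s) = E12 + i s E21, in the matrix summand. With l = lambda, the matrix is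
<<
      (    g(a)         l h(a)  )
      (  l^* h(-a)      g(-a)   )
>>
    and what there is to prove about it comes from the behaviour of g and h.

    - Whenever s^2 = 1, the coproduct sends g(s) to
      g(s) ⊗ g(s) + h(s) ⊗ h(-s) and h(s) to g(s) ⊗ h(s) + h(s) ⊗ g(-s)
      ([Delta_g], [Delta_h]). Taking s = a and s = -a gives the four
      comultiplication rules, since the scalars l and l^* cancel in products.
    - The matrix is unitary, so its conjugate transpose is its inverse.
    - If T commutes with the matrix, the (1,1) entry of the commutation relation
      equates T12 l^* h(-a) with T21 l h(a). As a is nonzero, h(a) and h(-a) are
      linearly independent, so T is diagonal; the (1,2) entry then makes the two
      diagonal entries of T equal.
    - h(a) and h(-a) span E12 and E21, whose products are E11 and E22, while
      g(a) and g(-a) span e1 - e4 and e2 - e3. The difference of two orthogonal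
      idempotents p and q satisfies (p - q)^2 = p + q, hence generates both.

    The two coproduct formulas only use that ⊗ is bilinear. They are therefore
    established for eight arbitrary vectors of an arbitrary vector space, as
    polynomial identities between coordinates, and then specialized. *)

(** * Two-by-two matrices *)

Lemma forall_ord2 (P : 'I_2 -> Prop) : P 0 -> P 1 -> forall i, P i.
Proof.
by move=> P0 P1 i; case: (splitP (m := 1) i) => k Ek;
  [rewrite (_ : i = 0) | rewrite (_ : i = 1)] => //; apply: val_inj;
  rewrite /= Ek ord1.
Qed.

Lemma sum_ord2 (V : nmodType) (F : 'I_2 -> V) : \sum_k F k = F 0 + F 1.
Proof.
by rewrite !big_ord_recl big_ord0 addr0; congr (_ + F _); apply: val_inj.
Qed.

Lemma mx2E (T : Type) (a b c d : T) :
  let M := mx2 a b c d in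
  (M 0 0 = a) * (M 0 1 = b) * (M 1 0 = c) * (M 1 1 = d).
Proof. by split; first split; first split; rewrite mxE. Qed.

Lemma mx2_eta {T : Type} (M : 'M[T]_2) :
  M = mx2 (M 0 0) (M 0 1) (M 1 0) (M 1 1).
Proof.
by apply/matrixP; apply: forall_ord2; apply: forall_ord2; rewrite mxE.
Qed.

Lemma mx2_inj {T : Type} {a b c d a' b' c' d' : T} :
  mx2 a b c d = mx2 a' b' c' d' -> [/\ a = a', b = b', c = c' & d = d'].
Proof.
move=> /matrixP E; have := (E 0 0, E 0 1, E 1 0, E 1 1).
by rewrite !mx2E => -[[[? ?] ?] ?].
Qed.

Lemma mx2_add (V : nmodType) (a b c d a' b' c' d' : V) :
  mx2 a b c d + mx2 a' b' c' d' = mx2 (a + a') (b + b') (c + c') (d + d').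
Proof. by rewrite [LHS]mx2_eta !mxE. Qed.

Lemma mx2_scale (R : pzRingType) (k a b c d : R) :
  k *: mx2 a b c d = mx2 (k * a) (k * b) (k * c) (k * d).
Proof. by rewrite [LHS]mx2_eta !mxE. Qed.

Lemma mx2_mul (R : pzRingType) (a b c d a' b' c' d' : R) :
  mx2 a b c d *m mx2 a' b' c' d' =
  mx2 (a * a' + b * c') (a * b' + b * d') (c * a' + d * c') (c * b' + d * d').
Proof. by rewrite [LHS]mx2_eta !mxE !sum_ord2 !mx2E. Qed.

Lemma mx2_scalar (R : pzRingType) (k : R) : k%:M = mx2 k 0 0 k.
Proof. by rewrite [LHS]mx2_eta !mxE. Qed.

Lemma mx2_0 (V : nmodType) : 0 = mx2 0 0 0 0 :> 'M[V]_2.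
Proof. by rewrite [LHS]mx2_eta !mxE. Qed.

Lemma addmx_coef (V : nmodType) m n (A B : 'M[V]_(m, n)) i j :
  (A + B) i j = A i j + B i j.
Proof. by rewrite mxE. Qed.

Lemma oppmx_coef (V : zmodType) m n (A : 'M[V]_(m, n)) i j :
  (- A) i j = - A i j.
Proof. by rewrite mxE. Qed.

Lemma scalemx_coef (R : pzRingType) m n k (A : 'M[R]_(m, n)) i j :
  (k *: A) i j = k * A i j.
Proof. by rewrite mxE. Qed.

Definition mx_coefE := (addmx_coef, oppmx_coef, scalemx_coef).

(** * The coproduct formulas in an arbitrary vector space *)

Section FormalCoproduct.
Variables (C : numClosedFieldType) (U : vectType C).
Variables e1 e2 e3 e4 E11 E12 E21 E22 : U.

Definition comult_e1 : tensor U U :=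
  e1 ⊗ e1 + e2 ⊗ e2 + e3 ⊗ e3 + e4 ⊗ e4
  + 2^-1 *: (E11 ⊗ E11) + 2^-1 *: (E12 ⊗ E12)
  + 2^-1 *: (E21 ⊗ E21) + 2^-1 *: (E22 ⊗ E22).

Definition comult_e2 : tensor U U :=
  e1 ⊗ e2 + e2 ⊗ e1 + e3 ⊗ e4 + e4 ⊗ e3
  + 2^-1 *: (E11 ⊗ E22) + 2^-1 *: (E22 ⊗ E11)
  - ('i / 2) *: (E12 ⊗ E21) + ('i / 2) *: (E21 ⊗ E12).

Definition comult_e3 : tensor U U :=
  e1 ⊗ e3 + e3 ⊗ e1 + e2 ⊗ e4 + e4 ⊗ e2
  + 2^-1 *: (E11 ⊗ E22) + 2^-1 *: (E22 ⊗ E11)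
  + ('i / 2) *: (E12 ⊗ E21) - ('i / 2) *: (E21 ⊗ E12).

Definition comult_e4 : tensor U U :=
  e1 ⊗ e4 + e4 ⊗ e1 + e2 ⊗ e3 + e3 ⊗ e2
  + 2^-1 *: (E11 ⊗ E11) + 2^-1 *: (E22 ⊗ E22)
  - 2^-1 *: (E12 ⊗ E12) - 2^-1 *: (E21 ⊗ E21).

Definition comult_E11 : tensor U U :=
  e1 ⊗ E11 + E11 ⊗ e1 + e2 ⊗ E22 + E22 ⊗ e2
  + e3 ⊗ E22 + E22 ⊗ e3 + e4 ⊗ E11 + E11 ⊗ e4.

Definition comult_E12 : tensor U U :=
  e1 ⊗ E12 + E12 ⊗ e1 + 'i *: (e2 ⊗ E21) - 'i *: (E21 ⊗ e2)
  - 'i *: (e3 ⊗ E21) + 'i *: (E21 ⊗ e3) - e4 ⊗ E12 - E12 ⊗ e4.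

Definition comult_E21 : tensor U U :=
  e1 ⊗ E21 + E21 ⊗ e1 - 'i *: (e2 ⊗ E12) + 'i *: (E12 ⊗ e2)
  + 'i *: (e3 ⊗ E12) - 'i *: (E12 ⊗ e3) - e4 ⊗ E21 - E21 ⊗ e4.

Definition comult_E22 : tensor U U :=
  e1 ⊗ E22 + E22 ⊗ e1 + e2 ⊗ E11 + E11 ⊗ e2
  + e3 ⊗ E11 + E11 ⊗ e3 + e4 ⊗ E22 + E22 ⊗ e4.

(** The right-hand side of the definition of [Delta], with the basis of the
    algebra replaced by eight vectors of [U]. Computing in the concrete tensor
    square is impractical, because comparing two of its terms may unfold the
    product structure of the algebra; here [U] is opaque. *)
Definition comult (x1 x2 x3 x4 a b c d : C) : tensor U U :=
  x1 *: comult_e1 + x2 *: comult_e2 + x3 *: comult_e3 + x4 *: comult_e4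
  + a *: comult_E11 + b *: comult_E12 + c *: comult_E21 + d *: comult_E22.

Lemma comultZ k x1 x2 x3 x4 a b c d :
  comult (k * x1) (k * x2) (k * x3) (k * x4) (k * a) (k * b) (k * c) (k * d) =
  k *: comult x1 x2 x3 x4 a b c d.
Proof. by rewrite /comult !(scalerDr k) !(scalerA k). Qed.

Lemma tens_coef (u v : U) p q : (u ⊗ v) p q = v2r u 0 p * v2r v 0 q.
Proof. by rewrite !mxE big_ord1 mxE. Qed.

Let g s := e1 + s *: e2 + (- s) *: e3 + (-1) *: e4.
Let h s := E12 + ('i * s) *: E21.

(* Otherwise matching the sum and scaling rules unfolds each tensor. *)
Local Opaque tens.

(** In the difference of the coproducts of e1 and e4 the terms in E11 and E22
    cancel, as they do in that of e2 and e3; the remaining terms in E12 and E21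
    make up h(s) ⊗ h(-s), and those in the e's the product g(s) ⊗ g(s). *)
Lemma comult_g s : s ^+ 2 = 1 ->
  comult 1 s (- s) (-1) 0 0 0 0 = g s ⊗ g s + h s ⊗ h (- s).
Proof.
move=> s2; have i2 := sqrCi C; rewrite /comult !scale0r !addr0.
rewrite /comult_e1 /comult_e2 /comult_e3 /comult_e4.
apply/matrixP => p q.
rewrite !mx_coefE !tens_coef !linearD !linearZ /= !mx_coefE.
by field: i2 s2.
Qed.

Lemma comult_h s : s ^+ 2 = 1 ->
  comult 0 0 0 0 0 1 ('i * s) 0 = g s ⊗ h s + h s ⊗ g (- s).
Proof.
move=> s2; have i2 := sqrCi C; rewrite /comult !scale0r !addr0 !add0r.
rewrite /comult_E12 /comult_E21.
apply/matrixP => p q.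
rewrite !mx_coefE !tens_coef !linearD !linearZ /= !mx_coefE.
by ring: i2 s2.
Qed.

End FormalCoproduct.

Arguments comult {C U}.
Arguments comult_e1 {C U}.
Arguments comult_e2 {C U}.
Arguments comult_e3 {C U}.
Arguments comult_e4 {C U}.
Arguments comult_E11 {C U}.
Arguments comult_E12 {C U}.
Arguments comult_E21 {C U}.
Arguments comult_E22 {C U}.

(** * Coordinates on the algebra *)

(** Locked, so that no unification or conversion sees through the nested pairs
    of the multi-matrix algebra. *)
HB.lock Definition kp (C : numClosedFieldType)
    (x1 x2 x3 x4 a b c d : C) : KP C :=
  dotplus x1 x2 x3 x4 (mx2 a b c d).
Arguments kp {C}.

Section KacPaljutkin.
Variable C : numClosedFieldType.
Implicit Types (a b c d l k s x y : C).

Lemma dotplus_kp x1 x2 x3 x4 a b c d :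
  dotplus x1 x2 x3 x4 (mx2 a b c d) = kp x1 x2 x3 x4 a b c d.
Proof. by rewrite unlock. Qed.

Lemma dotplus_kp0 x1 x2 x3 x4 :
  dotplus x1 x2 x3 x4 0 = kp x1 x2 x3 x4 0 0 0 0.
Proof. by rewrite unlock mx2_0. Qed.

Lemma kp_inj x1 x2 x3 x4 a b c d x1' x2' x3' x4' a' b' c' d' :
  kp x1 x2 x3 x4 a b c d = kp x1' x2' x3' x4' a' b' c' d' ->
  [/\ a = a', b = b', c = c' & d = d'].
Proof. by rewrite unlock => E; have /= /mx2_inj := congr1 snd E. Qed.

Lemma kp_add x1 x2 x3 x4 a b c d x1' x2' x3' x4' a' b' c' d' :
  kp x1 x2 x3 x4 a b c d + kp x1' x2' x3' x4' a' b' c' d' =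
  kp (x1 + x1') (x2 + x2') (x3 + x3') (x4 + x4')
     (a + a') (b + b') (c + c') (d + d').
Proof. by rewrite unlock /dotplus -mx2_add. Qed.

Lemma kp_scale k x1 x2 x3 x4 a b c d :
  k *: kp x1 x2 x3 x4 a b c d =
  kp (k * x1) (k * x2) (k * x3) (k * x4) (k * a) (k * b) (k * c) (k * d).
Proof. by rewrite unlock /dotplus -mx2_scale. Qed.

Lemma kp_mul x1 x2 x3 x4 a b c d x1' x2' x3' x4' a' b' c' d' :
  kp x1 x2 x3 x4 a b c d * kp x1' x2' x3' x4' a' b' c' d' =
  kp (x1 * x1') (x2 * x2') (x3 * x3') (x4 * x4')
     (a * a' + b * c') (a * b' + b * d') (c * a' + d * c') (c * b' + d * d').
Proof. by rewrite unlock /dotplus -mx2_mul. Qed.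

Lemma kp_1 : 1 = kp 1 1 1 1 1 0 0 1 :> KP C.
Proof. by rewrite unlock /dotplus -mx2_scalar. Qed.

Lemma kp_0 : 0 = kp 0 0 0 0 0 0 0 0 :> KP C.
Proof. by rewrite unlock /dotplus -mx2_0. Qed.

Definition kpE :=
  (dotplus_kp, dotplus_kp0, kp_0, kp_1, kp_scale, kp_mul, kp_add).

Lemma kp_basis x1 x2 x3 x4 a b c d :
  kp x1 x2 x3 x4 a b c d =
  x1 *: e1 C + x2 *: e2 C + x3 *: e3 C + x4 *: e4 C
  + a *: E11 C + b *: E12 C + c *: E21 C + d *: E22 C.
Proof.
rewrite /e1 /e2 /e3 /e4 /E11 /E12 /E21 /E22 !kpE.
by congr kp; ring.
Qed.

Lemma basis_decomposition (x : KP C) :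
  x = x.1.1.1.1 *: e1 C + x.1.1.1.2 *: e2 C + x.1.1.2 *: e3 C + x.1.2 *: e4 C
    + x.2 0 0 *: E11 C + x.2 0 1 *: E12 C + x.2 1 0 *: E21 C + x.2 1 1 *: E22 C.
Proof. by rewrite -kp_basis unlock -mx2_eta; case: x => -[[[]]]. Qed.

Lemma Delta_kp x1 x2 x3 x4 a b c d :
  Delta (kp x1 x2 x3 x4 a b c d) =
  comult (e1 C) (e2 C) (e3 C) (e4 C) (E11 C) (E12 C) (E21 C) (E22 C)
    x1 x2 x3 x4 a b c d.
Proof.
rewrite unlock /Delta /dotplus !mx2E.
(* Replacing one generator at a time keeps the conversion problems small. *)
have -> : Delta_e1 C =
  comult_e1 (e1 C) (e2 C) (e3 C) (e4 C) (E11 C) (E12 C) (E21 C) (E22 C) by [].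
have -> : Delta_e2 C =
  comult_e2 (e1 C) (e2 C) (e3 C) (e4 C) (E11 C) (E12 C) (E21 C) (E22 C) by [].
have -> : Delta_e3 C =
  comult_e3 (e1 C) (e2 C) (e3 C) (e4 C) (E11 C) (E12 C) (E21 C) (E22 C) by [].
have -> : Delta_e4 C =
  comult_e4 (e1 C) (e2 C) (e3 C) (e4 C) (E11 C) (E12 C) (E21 C) (E22 C) by [].
have -> : Delta_E11 C =
  comult_E11 (e1 C) (e2 C) (e3 C) (e4 C) (E11 C) (E22 C) by [].
have -> : Delta_E12 C =
  comult_E12 (e1 C) (e2 C) (e3 C) (e4 C) (E12 C) (E21 C) by [].
have -> : Delta_E21 C =
  comult_E21 (e1 C) (e2 C) (e3 C) (e4 C) (E12 C) (E21 C) by [].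
have -> : Delta_E22 C =
  comult_E22 (e1 C) (e2 C) (e3 C) (e4 C) (E11 C) (E22 C) by [].
by [].
Qed.

Lemma DeltaZ k (x : KP C) : Delta (k *: x) = k *: Delta x.
Proof.
case: x => -[[[x1 x2] x3] x4] M.
by rewrite -[(_, M)]/(dotplus x1 x2 x3 x4 M) [M]mx2_eta !kpE !Delta_kp comultZ.
Qed.

(** * The coefficient families and their coproducts *)

Definition g s : KP C := kp 1 s (- s) (-1) 0 0 0 0.
Definition h s : KP C := kp 0 0 0 0 0 1 ('i * s) 0.

Lemma g_basis s : g s = e1 C + s *: e2 C + (- s) *: e3 C + (-1) *: e4 C.
Proof. by rewrite /g kp_basis !scale0r !addr0 scale1r. Qed.

Lemma h_basis s : h s = E12 C + ('i * s) *: E21 C.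
Proof. by rewrite /h kp_basis !scale0r !addr0 !add0r scale1r. Qed.

Lemma Delta_g s : s ^+ 2 = 1 -> Delta (g s) = g s ⊗ g s + h s ⊗ h (- s).
Proof.
by move=> s2; rewrite {1}/g Delta_kp !g_basis !h_basis; apply: comult_g.
Qed.

Lemma Delta_h s : s ^+ 2 = 1 -> Delta (h s) = g s ⊗ h s + h s ⊗ g (- s).
Proof.
by move=> s2; rewrite {1}/h Delta_kp !g_basis !h_basis; apply: comult_h.
Qed.

(** * The representation *)

Section FrakX.
Variables a l : C.
Hypotheses (a2 : a ^+ 2 = 1) (ll : l * l^* = 1).

Lemma frakXE : frakX a l = mx2 (g a) (l *: h a) (l^* *: h (- a)) (g (- a)).
Proof.
by rewrite /frakX /g /h !kpE; congr (mx2 _ _ _ _); congr kp; ring.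
Qed.

Lemma frakX_comult i j :
  Delta (frakX a l i j) = \sum_k frakX a l i k ⊗ frakX a l k j.
Proof.
have a2' : (- a) ^+ 2 = 1 by rewrite sqrrN.
have tZl k (u v : KP C) : (k *: u) ⊗ v = k *: (u ⊗ v).
  by rewrite /tens linearZ /= linearZ /= -scalemxAl.
have tZr k (u v : KP C) : u ⊗ (k *: v) = k *: (u ⊗ v).
  by rewrite /tens linearZ /= -scalemxAr.
rewrite frakXE; move: i j; apply: forall_ord2; apply: forall_ord2;
  rewrite sum_ord2 !mx2E ?DeltaZ ?tZl ?tZr.
- by rewrite Delta_g // scalerA ll scale1r.
- by rewrite Delta_h // scalerDr.
- by rewrite Delta_h // opprK scalerDr addrC.
- by rewrite Delta_g // opprK scalerA mulrC ll scale1r addrC.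
Qed.

Lemma frakX_invertible : invertible_mx (frakX a l).
Proof.
have i2 := sqrCi C; rewrite frakXE.
(* The adjoints of h(s) and g(s) are E21 - i s E12 = - i s h(s) and g(s). *)
exists (mx2 (g a) (('i * a * l) *: h (- a))
            ((- 'i * a * l^*) *: h a) (g (- a)));
  rewrite /g /h !kpE mx2_mul mx2_scalar !kpE;
  by congr (mx2 _ _ _ _); congr kp; ring: a2 i2 ll.
Qed.

Lemma frakX_irreducible : irreducible (frakX a l).
Proof.
move=> T; rewrite frakXE [T]mx2_eta.
move: (T 0 0) (T 0 1) (T 1 0) (T 1 1) => p q r s.
have -> : scalar_ext (mx2 p q r s) = mx2 p%:A q%:A r%:A s%:A.
  by rewrite [LHS]mx2_eta !mxE.
rewrite /g /h !kpE !mx2_mul !kpE.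
(* The coordinates on E12 and E21 of the (1,1) entry, and that on E12 of the
   (1,2) entry. *)
move=> /mx2_inj[/kp_inj[_ E1 E2 _] /kp_inj[_ E3 _ _] _ _].
rewrite !(mulr0, mul0r, mulr1, mul1r, addr0, add0r) in E1 E2 E3.
have l0 : l != 0.
  by apply/eqP=> l0; move/eqP: ll; rewrite l0 mul0r eq_sym oner_eq0.
have l'0 : l^* != 0 by rewrite conjC_eq0.
have a0 : a != 0.
  by apply/eqP=> a0; move/eqP: a2; rewrite a0 expr0n eq_sym oner_eq0.
have eq_ps : p = s by apply: (mulIf l0); rewrite E3 mulrC.
have q0 : q = 0.
  have : 2 * 'i * a * l^* * q = 0.
    transitivity ('i * a * (l * r) - q * (l^* * ('i * - a))).
      by rewrite -E1; ring.
    by rewrite E2; ring.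
  move/eqP; rewrite !mulf_eq0 pnatr_eq0 (negPf (neq0Ci C)).
  by rewrite (negPf a0) (negPf l'0) => /eqP.
have r0 : r = 0 by apply: (mulfI l0); rewrite -E1 q0 mulr0 mul0r.
by exists p; rewrite mx2_scalar q0 r0 eq_ps.
Qed.

Lemma frakX_generate : coefs_generate (frakX a l).
Proof.
move=> S [S1 SL SM] SX.
have S0 : 0 \in S by have := SL (-1) _ _ S1 S1; rewrite scaleN1r addNr.
have SZ (k : C) (x : KP C) : x \in S -> k *: x \in S.
  by move=> Sx; rewrite -[_ *: _]addr0 SL.
have SD (x y : KP C) : x \in S -> y \in S -> x + y \in S.
  by move=> Sx Sy; rewrite -[x]scale1r SL.
have SB (x y : KP C) : x \in S -> y \in S -> x + (-1) *: y \in S.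
  by move=> Sx Sy; rewrite SD ?SZ.
have := (SX 0 0, SX 0 1, SX 1 0, SX 1 1); rewrite frakXE !mx2E.
case=> -[[Sg Slh] Slh'] Sg'.
have Sh : h a \in S.
  by have := SZ l^* _ Slh; rewrite scalerA mulrC ll scale1r.
have Sh' : h (- a) \in S by have := SZ l _ Slh'; rewrite scalerA ll scale1r.
have i2 := sqrCi C.
have SE12 : E12 C \in S.
  have -> : E12 C = 2^-1 *: (h a + h (- a)).
    by rewrite /h /E12 !kpE; congr kp; field.
  by rewrite SZ ?SD.
have SE21 : E21 C \in S.
  (* - i a / 2 is the inverse of 2 i a, as a^2 = 1. *)
  have -> : E21 C = (- 'i * a / 2) *: (h a + (-1) *: h (- a)).
    by rewrite /h /E21 !kpE; congr kp; field: i2 a2.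
  by rewrite SZ ?SB.
have SE11 : E11 C \in S.
  have -> : E11 C = E12 C * E21 C.
    by rewrite /E11 /E12 /E21 !kpE; congr kp; ring.
  exact: SM.
have SE22 : E22 C \in S.
  have -> : E22 C = E21 C * E12 C.
    by rewrite /E22 /E12 /E21 !kpE; congr kp; ring.
  exact: SM.
(* u = e1 - e4 and v = e2 - e3 *)
pose u := 2^-1 *: (g a + g (- a)).
pose v := (a / 2) *: (g a + (-1) *: g (- a)).
have Su : u \in S by rewrite SZ ?SD.
have Sv : v \in S by rewrite SZ ?SB.
have Se1 : e1 C \in S.
  have -> : e1 C = 2^-1 *: (u * u + u).
    by rewrite /u /g /e1 !kpE; congr kp; field.
  by rewrite SZ ?SD ?SM.
have Se4 : e4 C \in S.
  have -> : e4 C = 2^-1 *: (u * u + (-1) *: u).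
    by rewrite /u /g /e4 !kpE; congr kp; field.
  by rewrite SZ ?SB ?SM.
have Se2 : e2 C \in S.
  have -> : e2 C = 2^-1 *: (v * v + v).
    by rewrite /v /g /e2 !kpE; congr kp; field: a2.
  by rewrite SZ ?SD ?SM.
have Se3 : e3 C \in S.
  have -> : e3 C = 2^-1 *: (v * v + (-1) *: v).
    by rewrite /v /g /e3 !kpE; congr kp; field: a2.
  by rewrite SZ ?SB ?SM.
move=> x; rewrite (basis_decomposition x).
by do 7! [apply: (SD); last exact: SZ]; exact: SZ.
Qed.

End FrakX.

End KacPaljutkin.

Theorem proposition2p1 (R : realType) (a lambda : R[i])
    (ha : a \in [:: -1; 1]) (hlambda : `|lambda| = 1) :
  fundamental_representation (frakX a lambda).
Proof.
have a2 : a ^+ 2 = 1.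
  by move: ha; rewrite !inE => /orP[] /eqP ->; rewrite ?sqrrN expr1n.
have ll : lambda * lambda^* = 1 by rewrite -normCK hlambda expr1n.
split; first split.
- exact: frakX_invertible.
- exact: frakX_comult.
- exact: frakX_irreducible.
- exact: frakX_generate.
Qed.
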